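(* Let $m,n\ge 1$, let $\{(X^i,P^i),\ 1\le i\le n\}\subset \mathbb{R}^m_+\times\mathbb{R}^m_+$ be a finite set, and let $c(x,y)=\ln\langle x,y\rangle$ for $x,y\in\mathbb{R}^m_+$. Put $$\mu=\frac1n\sum_{i=1}^n\delta_{X^i},\qquad \nu=\frac1n\sum_{i=1}^n\delta_{P^i},\qquad \pi=\frac1n\sum_{i=1}^n\delta_{(X^i,P^i)}.$$ The following statements are equivalent: 1) $\pi$ is a solution to the Monge--Kantorovich problem with marginals $\mu,\nu$ and the cost function $c$; 2) the set $\{(X^i,P^i),\ 1\le i\le n\}$ is $c$-cyclically monotone; 3) the set $\{(X^i,P^i),\ 1\le i\le n\}$ admits a positive homogeneous utility function $u$.
   Context: Notation: $\mathbb{R}_+=(0,+\infty)$, so $\mathbb{R}^m_+$ is the set of vectors with strictly positive coordinates; $\langle\cdot,\cdot\rangle$ is the standard scalar product; $\delta_a$ is the Dirac measure at $a$. Monge--Kantorovich problem: given probability measures $\mu,\nu$ on $\mathbb{R}^m_+$ and a cost function $c$, let $P_{\mu,\nu}$ be the set of probability measures on $\mathbb{R}^m_+\times\mathbb{R}^m_+$ whose projections onto the first and second factors are $\mu$ and $\nu$ respectively. A measure $P$ solves the Monge--Kantorovich problem with marginals $\mu,\nu$ and cost $c$ if $P\in P_{\mu,\nu}$ and $P$ minimizes $\int c(x,y)\,dP$ over $P_{\mu,\nu}$. $c$-cyclical monotonicity: a set $A\subset\mathbb{R}^m_+\times\mathbb{R}^m_+$ is $c$-cyclically monotone if every finite subset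 $\{(x_i,y_i),\ 1\le i\le k\}\subset A$ (with any enumeration of its elements) satisfies $\sum_{i=1}^k c(x_i,y_i)\le\sum_{i=1}^k c(x_i,y_{i+1})$, where $y_{k+1}=y_1$. Utility function: the set $\{(X^i,P^i)\}$ admits a utility function $u:\mathbb{R}^m_+\to\mathbb{R}$ if for every $i$ and every $Y\in\mathbb{R}^m_+$ with $\langle Y,P^i\rangle<\langle X^i,P^i\rangle$ one has $u(Y)<u(X^i)$. The function $u$ is positive homogeneous if $u>0$ and $u(tX)=t\,u(X)$ for all $X\in\mathbb{R}^m_+$, $t\in\mathbb{R}_+$. *)

(* Defs.v *)
From HB Require Import structures.
From mathcomp Require Import all_boot all_order all_algebra.
From mathcomp Require Import all_classical all_reals all_analysis.

Set Implicit Arguments.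
Unset Strict Implicit.
Unset Printing Implicit Defensive.

Import Order.TTheory GRing.Theory Num.Theory.
Import numFieldNormedType.Exports.

Local Open Scope classical_set_scope.
Local Open Scope ring_scope.

Section PosVec.
Context (R : realType) (m : nat).

Definition coords_gt0 (v : 'rV[R]_m) : bool := [forall j, 0 < v 0 j].

Record posvec := PosVec { vec : 'rV[R]_m ; vec_gt0 : coords_gt0 vec }.

HB.instance Definition _ := [isSub for vec].
HB.instance Definition _ := [Choice of posvec by <:].

Fact coords_gt0_const1 : coords_gt0 (const_mx 1).
Proof. by apply/forallP => j; rewrite mxE ltr01. Qed.

HB.instance Definition _ := isPointed.Build posvec (PosVec coords_gt0_const1).

Definition pos_coord (j : 'I_m) (x : posvec) : R := vec x 0 j.

(* The sigma-algebra generated by the coordinates, as for [n.-tuple T] in the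
   library; it is the Borel sigma-algebra of the open orthant. *)
HB.instance Definition _ := @isMeasurable.Build (measure_tuple_display
    default_measure_display) posvec
  (g_sigma_preimage pos_coord)
  (@sigma_algebra0 _ setT _) (@sigma_algebraC _ _)
  (@sigma_algebra_bigcup _ setT _).

Definition dotv (x y : posvec) : R := \sum_(j < m) vec x 0 j * vec y 0 j.

Fact coords_gt0_scale (t : {posnum R}) (x : posvec) :
  coords_gt0 (t%:num *: vec x).
Proof.
by apply/forallP => j; rewrite mxE mulr_gt0//; exact: (forallP (vec_gt0 x)).
Qed.

Definition scalev (t : {posnum R}) (x : posvec) : posvec :=
  PosVec (coords_gt0_scale t x).

Definition log_cost (x y : posvec) : R := ln (dotv x y).

Definition utility_for (A : set (posvec * posvec)) (u : posvec -> R) : Prop :=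
  forall XP, A XP -> forall Y, dotv Y XP.2 < dotv XP.1 XP.2 -> u Y < u XP.1.

Definition positive_homogeneous (u : posvec -> R) : Prop :=
  (forall x, 0 < u x) /\ (forall t x, u (scalev t x) = t%:num * u x).

End PosVec.

Section Empirical.
Context d (T : measurableType d) (R : realType) (n : nat).
Local Open Scope ereal_scope.

(* The proof that [0 < n] is an argument so that the instance of probability
   measure below can be inferred. *)
Definition empirical (n_gt0 : (0 < n)%N) (X : 'I_n -> T) : set T -> \bar R :=
  fun A => (n%:R^-1)%:E * \sum_(i < n) \d_(X i) A.

Variables (n_gt0 : (0 < n)%N) (X : 'I_n -> T).
Local Notation emp := (empirical n_gt0 X).

Let emp0 : emp set0 = 0.
Proof. by rewrite /empirical big1 ?mule0// => i _; rewrite measure0. Qed.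

Let emp_ge0 A : 0 <= emp A.
Proof. by rewrite mule_ge0 ?lee_fin ?invr_ge0 ?ler0n// sume_ge0. Qed.

Let emp_sigma_additive : semi_sigma_additive emp.
Proof.
move=> F mF tF mUF.
rewrite [X in X @ _ --> _](_ : _ = fun k => (n%:R^-1)%:E *
    \sum_(i < n) \sum_(0 <= j < k) \d_(X i) (F j)); last first.
  apply/funext => k; rewrite exchange_big/= ge0_sume_distrr//.
  by move=> j _; exact: sume_ge0.
apply: cvgeZl => //; apply: cvg_nnesum => i _.
  by apply: nearW => k; exact: sume_ge0.
exact: measure_semi_sigma_additive.
Qed.

HB.instance Definition _ :=
  isMeasure.Build _ _ _ emp emp0 emp_ge0 emp_sigma_additive.

Let emp_setT : emp setT = 1.
Proof.
rewrite /empirical (eq_bigr (fun=> 1)); last by move=> i _; rewrite diracT.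
by rewrite sumEFin -EFinM sumr_const card_ord mulVf// pnatr_eq0 -lt0n.
Qed.

HB.instance Definition _ := Measure_isProbability.Build _ _ _ emp emp_setT.

End Empirical.

Section MongeKantorovich.
Context d1 d2 (T1 : measurableType d1) (T2 : measurableType d2) (R : realType).

Definition couplings (mu : probability T1 R) (nu : probability T2 R) :
    set (probability (T1 * T2)%type R) :=
  [set P | (forall A, measurable A -> pushforward P fst A = mu A) /\
           (forall B, measurable B -> pushforward P snd B = nu B)].

(* As usual in the library, the integral of a function whose positive and
   negative parts both have infinite integral is the junk value [+oo - +oo].
   This cannot occur when [mu] and [nu] are finitely supported. *)
Definition transport_cost (c : T1 -> T2 -> R)
    (P : probability (T1 * T2)%type R) : \bar R :=
  (\int[P]_z (c z.1 z.2)%:E)%E.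

Definition solves_MK (mu : probability T1 R) (nu : probability T2 R)
    (c : T1 -> T2 -> R) (P : probability (T1 * T2)%type R) : Prop :=
  couplings mu nu P /\
  forall Q, couplings mu nu Q -> (transport_cost c P <= transport_cost c Q)%E.

End MongeKantorovich.

(* Enumerations of finite subsets are injective maps from ['I_k]; [ordS] is the
   cyclic successor. *)
Definition cyclically_monotone (T1 T2 : Type) (R : realType)
    (c : T1 -> T2 -> R) (A : set (T1 * T2)) : Prop :=
  forall (k : nat) (s : 'I_k -> T1 * T2),
    injective s -> (forall i, A (s i)) ->
    \sum_(i < k) c (s i).1 (s i).2 <= \sum_(i < k) c (s i).1 (s (ordS i)).2.

(* Main.v *)
(* Both optimality and the existence of a utility are equivalent to the existence
   of numbers [a_i] with [a_i + c(X_i, P_i) <= a_j + c(X_i, P_j)] for all [i, j].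
   Cyclic monotonicity provides them: [a_j] is the largest weight of a walk
   ending at [j], where a step from [i] to [j] weighs
   [c(X_i, P_i) - c(X_i, P_j)].
   Then [u(Y) = min_i exp(a_i) <Y, P_i>] is a homogeneous utility, and
   [f(X_i) = a_i + c(X_i, P_i)], [g(P_i) = - a_i] are Kantorovich potentials,
   which certify the optimality of [pi]. Conversely, a homogeneous utility gives
   [u(X_j) <X_i, P_i> <= u(X_i) <X_j, P_i>], whose logarithms sum to cyclic
   monotonicity along cycles; and if [pi] is optimal, comparing it with the
   coupling that permutes the [P_i] along a cycle gives cyclic monotonicity. *)

Require Import Defs.
From mathcomp Require Import all_boot all_order all_algebra.
From mathcomp Require Import all_classical all_reals all_analysis.
From mathcomp Require Import measurable_realfun.

Set Implicit Arguments.
Unset Strict Implicit.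
Unset Printing Implicit Defensive.

Import Order.TTheory GRing.Theory Num.Theory.
Import numFieldNormedType.Exports.

Local Open Scope classical_set_scope.
Local Open Scope ring_scope.

(** * Walks in a weighted graph and potentials *)

Section Walks.
Context (R : realType) (T : Type) (w : T -> T -> R).

Fixpoint walk_weight (x : T) (p : seq T) : R :=
  if p is y :: p' then w x y + walk_weight y p' else 0.

Lemma walk_weight_cat x p q :
  walk_weight x (p ++ q) = walk_weight x p + walk_weight (last x p) q.
Proof. by elim: p x => [|y p IHp] x /=; rewrite ?add0r// IHp addrA. Qed.

Lemma walk_weight_rcons x p y :
  walk_weight x (rcons p y) = walk_weight x p + w (last x p) y.
Proof. by rewrite -cats1 walk_weight_cat/= addr0. Qed.

Lemma walk_weightE x0 x p : walk_weight x p =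
  \sum_(i < size p) w (nth x0 (x :: p) i) (nth x0 p i).
Proof.
elim: p x => [|z p IHp] x; first by rewrite big_ord0.
by rewrite big_ord_recl/= IHp.
Qed.

(** Matches closed walks with the cyclic sums over [ordS] used in [cyclically_monotone]. *)
Lemma closed_walk_weightE x p : walk_weight x (rcons p x) =
  \sum_(i < (size p).+1) w (nth x (x :: p) i) (nth x (x :: p) (ordS i)).
Proof.
rewrite (walk_weightE x) size_rcons; apply: eq_bigr => i _.
have ip : (i <= size p)%N by rewrite -ltnS.
rewrite -rcons_cons nth_rcons/= ltnS ip; congr w.
(* At the last index, [i = size p], the walk returns to [x] and [ordS] wraps around to 0. *)
rewrite nth_rcons; move: ip; rewrite leq_eqVlt => /orP[/eqP ->|ip].
  by rewrite ltnn eqxx modnn.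
by rewrite ip modn_small.
Qed.

End Walks.

(* Nonpositive simple cycles suffice: when appending [j] to a simple walk would
   revisit [j], the closed part can be dropped without losing weight. *)
Lemma potential_of_simple_cycles (R : realType) (T : finType) (w : T -> T -> R) :
  (forall x p, uniq (x :: p) -> walk_weight w x (rcons p x) <= 0) ->
  exists a : T -> R, forall i j, a i + w i j <= a j.
Proof.
move=> cyc.
pose W j := [set r | exists x p,
  [/\ uniq (x :: p), last x p = j & r = walk_weight w x p]].
have W0 j : W j !=set0 by exists 0, j, [::].
(* [M] bounds the weight of every step. A simple walk has fewer than [#|T|] steps, so each [W j] is
   bounded and its supremum is genuine. *)
pose M := \sum_i \sum_j `|w i j|.
have wM i j : w i j <= M.
  rewrite (le_trans (ler_norm _))// /M (bigD1 i)//= (bigD1 j)//= -addrA lerDl.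
  by rewrite addr_ge0// ?sumr_ge0// => k _; rewrite sumr_ge0.
have M0 : 0 <= M by rewrite sumr_ge0// => i _; rewrite sumr_ge0.
have Wub j : has_ubound (W j).
  exists (M *+ #|T|) => _ [x [p [/card_uniqP xp _ ->]]].
  apply: (@le_trans _ _ (M *+ size p)).
    by elim: p x {xp} => //= y p IHp x; rewrite mulrS lerD.
  apply: ler_wpMn2l => //; have := max_card (mem (x :: p)).
  by rewrite xp /=; exact: ltnW.
exists (fun j => sup (W j)) => i j; rewrite -lerBrDr; apply: ge_sup => //.
move=> _ [x [p [xp pi ->]]]; rewrite lerBrDr -{1}pi -walk_weight_rcons.
have [jxp|jxp] := boolP (j \in x :: p); last first.
  apply: ub_le_sup => //; exists x, (rcons p j); split => //.
    by rewrite -rcons_cons rcons_uniq jxp.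
  by rewrite last_rcons.
(* The walk splits at its visit to [j]: [p1] ends there, and [rcons p2 j] closes a simple cycle from
   [j], of weight at most 0. *)
case/splitPl: jxp xp pi => p1 p2 p1j xp pi.
rewrite rcons_cat walk_weight_cat p1j.
apply: (@le_trans _ _ (walk_weight w x p1)).
  rewrite gerDl; apply: cyc; move: xp; rewrite -cat_cons lastI p1j cat_rcons.
  by rewrite cat_uniq => /and3P[].
apply: ub_le_sup => //; exists x, p1; split => //.
by move: xp; rewrite -cat_cons cat_uniq => /and3P[].
Qed.

(** * Cyclic monotonicity, potentials and permutations *)

(** Pairs may repeat among the indices, while cyclic monotonicity enumerates distinct pairs. Walks
    therefore run on the finite type of distinct pairs, where a simple walk is an injective
    enumeration. *)
Lemma cyclically_monotone_potential (R : realType) (T1 T2 : choiceType)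
    (c : T1 -> T2 -> R) n (X : 'I_n -> T1) (Y : 'I_n -> T2) :
  cyclically_monotone c (range (fun i => (X i, Y i))) ->
  exists a : 'I_n -> R, forall i j, a i + c (X i) (Y i) <= a j + c (X i) (Y j).
Proof.
move=> cm; pose s := codom (fun i => (X i, Y i)).
pose w (u v : seq_sub s) := c (val u).1 (val u).2 - c (val u).1 (val v).2.
have [x p xp|a aP] := @potential_of_simple_cycles R (seq_sub s) w.
  rewrite closed_walk_weightE big_split/= sumrN subr_le0.
  apply: (cm _ (fun i : 'I_(size p).+1 => val (nth x (x :: p) i))).
    move=> i j /val_inj/eqP; rewrite nth_uniq ?ltn_ord// => /eqP; exact: val_inj.
  by move=> i; have /codomP[k ->] := valP (nth x (x :: p) i); exists k.
pose v i : seq_sub s := SeqSub (codom_f (fun i => (X i, Y i)) i).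
exists (fun i => a (v i)) => i j; have := aP (v i) (v j).
by rewrite /w/= addrA lerBlDr.
Qed.

(** A cycle of pairs extends to a permutation of the indices that fixes everything off the cycle;
    fixed indices contribute equally to both sums. *)
Lemma cyclically_monotone_reindex (R : realType) (T1 T2 : Type)
    (c : T1 -> T2 -> R) n (X : 'I_n -> T1) (Y : 'I_n -> T2) :
  (forall s : 'I_n -> 'I_n, injective s ->
    \sum_(i < n) c (X i) (Y i) <= \sum_(i < n) c (X i) (Y (s i))) ->
  cyclically_monotone c (range (fun i => (X i, Y i))).
Proof.
move=> opt k t t_inj tXY.
have /choice[e eP] (a : 'I_k) : exists i, (X i, Y i) = t a.
  by have [i _ <-] := tXY a; exists i.
have e_inj : injective e by move=> a b eab; apply: t_inj; rewrite -!eP eab.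
(* [e] chooses an index for each pair of the cycle; [s] moves along the cycle on the image of [e]
   and is the identity elsewhere. *)
pose s i := if [pick a | e a == i] is Some a then e (ordS a) else i.
have se a : s (e a) = e (ordS a).
  rewrite /s; case: pickP => [b /eqP/e_inj ->//|/(_ a)]; by rewrite eqxx.
have sN i : i \notin codom e -> s i = i.
  rewrite /s; case: pickP => // b /eqP <-; by rewrite codom_f.
have sC i : (s i \in codom e) = (i \in codom e).
  apply/idP/idP; last by case/codomP => a ->; rewrite se codom_f.
  by apply: contraTT => iN; rewrite sN.
have s_inj : injective s.
  move=> i j sij; have := sC i; rewrite sij sC.
  have [/codomP[b jb]|jN] := boolP (j \in codom e) => /esym.
    case/codomP => a ia; move: sij; rewrite ia jb !se.
    by move=> /e_inj/ordS_inj ->.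
  by move=> /negbT iN; move: sij; rewrite !sN.
have split_sum F : \sum_(i < n) F i =
    \sum_(a < k) F (e a) + \sum_(i < n | i \notin codom e) F i :> R.
  rewrite (bigID (mem (codom e)))/=; congr (_ + _).
  rewrite -big_uniq/=; first by rewrite big_map big_enum.
  by rewrite map_inj_uniq ?enum_uniq.
have := opt _ s_inj; rewrite !split_sum.
under [X in _ <= _ + X -> _]eq_bigr => i iN do rewrite sN//.
rewrite lerD2r; congr (_ <= _); apply: eq_bigr => a _; first by rewrite -eP.
by rewrite se -!eP.
Qed.

(** * Integration against finitely supported measures *)

Lemma set_seq_bigsetU (T : choiceType) (s : seq T) :
  [set` s] = \big[setU/set0]_(x <- s) [set x].
Proof.
by rewrite -bigcup_seq; apply/seteqP; split => [x xs|x [y ys ->]//]; exists x.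
Qed.

Section FiniteSupport.
Context d (T : measurableType d) (R : realType).
Hypothesis measurable_set1 : forall x : T, measurable [set x].

Lemma measurable_set_seq (s : seq T) : measurable [set` s].
Proof. by rewrite set_seq_bigsetU; exact: bigsetU_measurable. Qed.

(** The null complement contributes nothing, and [f] is constant on each of the finitely many
    singletons that remain. *)
Lemma integral_finite_support (Q : {finite_measure set T -> \bar R})
    (s : seq T) (f : T -> R) :
  uniq s -> Q (~` [set` s]) = 0%E -> measurable_fun setT f ->
  (\int[Q]_x (f x)%:E = (\sum_(x <- s) f x * fine (Q [set x]))%:E)%E.
Proof.
move=> us Qs mf.
have mfE : measurable_fun setT (EFin \o f) by exact/measurable_EFinP.
have ms := measurable_set_seq s.
rewrite -(setUv [set` s]) integral_setU//; last 3 first.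
- exact: measurableC.
- by rewrite setUv.
- exact/disj_setPCl.
have -> : (\int[Q]_(x in ~` [set` s]) (f x)%:E = 0)%E.
  rewrite (ae_eq_integral (cst 0%E)) ?integral0//.
  - exact: measurableC.
  - exact: measurable_funTS.
  - exists (~` [set` s]); split => //; first exact: measurableC.
    by move=> x /= /not_implyP[].
rewrite adde0 set_seq_bigsetU integral_bigsetU_EFin//; first last.
- exact: measurable_funTS.
- by apply/trivIsetP => x y _ _ /eqP xy; apply/seteqP; split => // z [/= -> /xy].
rewrite -sumEFin; apply: eq_bigr => x _.
rewrite (eq_integral (cst (f x)%:E)); last by move=> y /set_mem ->.
rewrite integral_cst//= EFinM fineK//; exact: fin_num_measure.
Qed.

Lemma empirical_setC_codom n (n_gt0 : (0 < n)%N) (X : 'I_n -> T) :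
  empirical R n_gt0 X (~` [set` undup (codom X)]) = 0%E.
Proof.
rewrite /empirical big1 ?mule0// => i _; rewrite diracE memNset//=.
by move=> /(_ _) /=; rewrite mem_undup codom_f; apply.
Qed.

(** Double counting: each distinct value [x] has mass 1/n times the number of indices [i] with
    [X i = x]. *)
Lemma sum_empirical n (n_gt0 : (0 < n)%N) (X : 'I_n -> T) (f : T -> R) :
  \sum_(x <- undup (codom X)) f x * fine (empirical R n_gt0 X [set x]) =
  n%:R^-1 * \sum_(i < n) f (X i).
Proof.
transitivity (\sum_(x <- undup (codom X)) \sum_(i < n)
    n%:R^-1 * (f (X i) * (X i == x)%:R)).
  apply: eq_bigr => x _; rewrite /empirical.
  rewrite (eq_bigr (fun i => (X i == x)%:R%:E)); last first.
    move=> i _; rewrite diracE (_ : (X i \in [set x]) = (X i == x))//.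
    by apply/idP/eqP => [/set_mem//|/mem_set].
  rewrite sumEFin -EFinM/= mulrCA !mulr_sumr; apply: eq_bigr => i _.
  by case: eqP => [->|]; rewrite ?mulr1 ?mulr0.
rewrite exchange_big/= mulr_sumr; apply: eq_bigr => i _.
rewrite -mulr_sumr -mulr_sumr (bigD1_seq (X i)) ?undup_uniq//=; last first.
  by rewrite mem_undup codom_f.
by rewrite eqxx big1 ?addr0 ?mulr1// => x; rewrite eq_sym => /negbTE ->.
Qed.

Lemma integral_empirical n (n_gt0 : (0 < n)%N) (X : 'I_n -> T) (f : T -> R) :
  measurable_fun setT f ->
  (\int[empirical R n_gt0 X]_x (f x)%:E = (n%:R^-1 * \sum_(i < n) f (X i))%:E)%E.
Proof.
move=> mf; rewrite (integral_finite_support (undup_uniq (codom X)))//=.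
  by rewrite sum_empirical.
exact: empirical_setC_codom.
Qed.

End FiniteSupport.

Section EmpiricalMarginal.
Context d d' (T : measurableType d) (T' : measurableType d') (R : realType).
Hypothesis measurable_set1 : forall x : T, measurable [set x].
Hypothesis measurable_set1' : forall x : T', measurable [set x].

(** Grouping the atoms of [Q] by their image under [p] leaves a sum over the atoms of the
    marginal. *)
Lemma sum_marginal (Q : {finite_measure set T' -> \bar R}) (p : T' -> T)
    n (n_gt0 : (0 < n)%N) (X : 'I_n -> T) (s : seq T') (f : T -> R) :
  measurable_fun setT p ->
  (forall A, measurable A -> pushforward Q p A = empirical R n_gt0 X A) ->
  uniq s -> Q (~` [set` s]) = 0%E -> (forall z, z \in s -> p z \in codom X) ->
  \sum_(z <- s) f (p z) * fine (Q [set z]) = n%:R^-1 * \sum_(i < n) f (X i).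
Proof.
move=> mp pQ us Qs sX; rewrite -(sum_empirical n_gt0).
transitivity (\sum_(z <- s) \sum_(x <- undup (codom X))
    f x * ((p z == x)%:R * fine (Q [set z]))).
  apply: eq_big_seq => z zs.
  rewrite (bigD1_seq (p z)) ?undup_uniq ?mem_undup ?sX//= eqxx mul1r.
  rewrite big1 ?addr0// => x.
  by rewrite eq_sym => /negbTE ->; rewrite mul0r mulr0.
rewrite exchange_big; apply: eq_bigr => x _; rewrite -mulr_sumr -pQ//.
congr (_ * _); rewrite /pushforward.
have mpx : measurable (p @^-1` [set x]).
  by rewrite -[X in measurable X]setTI; exact: mp.
apply: EFin_inj; rewrite fineK ?fin_num_measure//.
(* The mass of a fibre of [p] is the integral of its indicator, hence a finite sum over [s]. *)
rewrite -[X in _ = _ X]setIT -integral_indic//.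
rewrite (integral_finite_support _ us)//; congr EFin; apply: eq_bigr => z _.
congr (_ * _); rewrite indicE; congr (_%:R).
rewrite (_ : (p z == x) = (z \in p @^-1` [set x]))//.
by apply/eqP/idP => [?|/set_mem//]; exact: mem_set.
Qed.

End EmpiricalMarginal.

(** * Couplings of empirical measures and weak duality *)

Section Couplings.
Context d1 d2 (T1 : measurableType d1) (T2 : measurableType d2) (R : realType).
Hypothesis measurable_set11 : forall x : T1, measurable [set x].
Hypothesis measurable_set12 : forall x : T2, measurable [set x].
Variables (n : nat) (n_gt0 : (0 < n)%N) (X : 'I_n -> T1) (Y : 'I_n -> T2).
Variable c : T1 -> T2 -> R.
Hypothesis measurable_c : measurable_fun setT (fun z : T1 * T2 => c z.1 z.2).

Local Notation mu := (empirical R n_gt0 X).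
Local Notation nu := (empirical R n_gt0 Y).
Local Notation pi := (empirical R n_gt0 (fun i => (X i, Y i))).

Let measurable_set1X (z : T1 * T2) : measurable [set z].
Proof.
case: z => x y; rewrite (_ : [set (x, y)] = [set x] `*` [set y]).
  exact: measurableX.
by apply/seteqP; split => [_ ->|[_ _] [/= -> ->]].
Qed.

Let S := [seq (x, y) | x <- undup (codom X), y <- undup (codom Y)].

Let uniq_S : uniq S.
Proof. by apply: allpairs_uniq; rewrite ?undup_uniq// => -[? ?] [? ?]. Qed.

Let mem_S z : (z \in S) = (z.1 \in codom X) && (z.2 \in codom Y).
Proof.
apply/allpairsP/andP => [[[x y] /= [xX yY ->]]|[zX zY]] /=.
  by move: xX yY; rewrite !mem_undup.
by exists z; rewrite !mem_undup zX zY; case: z {zX zY}.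
Qed.

(** Outside the grid [S], one of the two coordinates leaves the support of its marginal, so the
    complement lies in a union of two null cylinders. *)
Let coupling_S Q : couplings mu nu Q -> Q (~` [set` S]) = 0%E.
Proof.
move=> [Q1 Q2].
have mX := measurableC (measurable_set_seq measurable_set11 (undup (codom X))).
have mY := measurableC (measurable_set_seq measurable_set12 (undup (codom Y))).
have m1 : measurable (fst @^-1` (~` [set` undup (codom X)]) : set (T1 * T2)).
  by rewrite -[X in measurable X]setTI; exact: measurable_fst.
have m2 : measurable (snd @^-1` (~` [set` undup (codom Y)]) : set (T1 * T2)).
  by rewrite -[X in measurable X]setTI; exact: measurable_snd.
apply: (@subset_measure0 _ _ _ Q _ ((fst @^-1` (~` [set` undup (codom X)])) `|`
    (snd @^-1` (~` [set` undup (codom Y)])))).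
- exact/measurableC/measurable_set_seq.
- exact: measurableU.
- move=> z /= /negP; rewrite mem_S negb_and !mem_undup.
  by case/orP => /negP; [left|right].
- apply: (etrans (measureU0 m1 m2 _)).
    exact: etrans (Q2 _ mY) (empirical_setC_codom _ _ _).
  exact: etrans (Q1 _ mX) (empirical_setC_codom _ _ _).
Qed.

Lemma empirical_reindex_coupling (s : 'I_n -> 'I_n) : injective s ->
  couplings mu nu (empirical R n_gt0 (fun i => (X i, Y (s i)))).
Proof.
move=> s_inj; split => [A mA|B mB]//.
rewrite /pushforward /= /empirical.
by rewrite [X in (_ = _ * X)%E](reindex_inj s_inj).
Qed.

Lemma solves_MK_reindex (s : 'I_n -> 'I_n) : injective s ->
  solves_MK mu nu c pi ->
  \sum_(i < n) c (X i) (Y i) <= \sum_(i < n) c (X i) (Y (s i)).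
Proof.
move=> s_inj [_ /(_ _ (empirical_reindex_coupling s_inj))].
rewrite /transport_cost !integral_empirical//= lee_fin ler_pM2l//.
by rewrite invr_gt0 ltr0n.
Qed.

(** Weak duality: the total of [f + g] is the same for all couplings. It equals the cost of [pi] and
    is at most the cost of any [Q], which lives on the grid where [f + g <= c]. *)
Lemma solves_MK_potential (f : T1 -> R) (g : T2 -> R) :
  (forall i j, f (X i) + g (Y j) <= c (X i) (Y j)) ->
  (forall i, f (X i) + g (Y i) = c (X i) (Y i)) ->
  solves_MK mu nu c pi.
Proof.
move=> fgle fgE; split=> [|Q Q_coupl].
  exact: (empirical_reindex_coupling (s := id)).
have QS := coupling_S Q_coupl; case: Q_coupl => Q1 Q2.
rewrite /transport_cost integral_empirical// (integral_finite_support _ uniq_S)//.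
rewrite lee_fin/= -(eq_bigr _ (fun i _ => fgE i)) big_split/= mulrDr.
(* The averages of [f] and [g] become sums over [S] weighted by [Q], to be compared with its cost
   atom by atom. *)
rewrite -(sum_marginal measurable_set11 measurable_set1X f measurable_fst
    Q1 uniq_S QS)//; last 1 first.
  by move=> z; rewrite mem_S => /andP[].
rewrite -(sum_marginal measurable_set12 measurable_set1X g measurable_snd
    Q2 uniq_S QS)//; last 1 first.
  by move=> z; rewrite mem_S => /andP[].
rewrite -big_split/= !big_seq; apply: ler_sum => z.
rewrite mem_S => /andP[/codomP[i zi] /codomP[j zj]].
by rewrite -mulrDl zi zj ler_wpM2r// fine_ge0.
Qed.

End Couplings.

(** * Optimality and cyclic monotonicity for a general cost *)

(** Turns numbers attached to indices into a function of points; off the range of [X] the default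
    value [point] is taken. *)
Lemma factor_through (I : finType) (T : eqType) (V : pointedType)
    (X : I -> T) (h : I -> V) :
  (forall i j, X i = X j -> h i = h j) ->
  exists f : T -> V, forall i, f (X i) = h i.
Proof.
move=> Xh; exists (fun x => if [pick i | X i == x] is Some i then h i else point).
by move=> i; case: pickP => [j /eqP/Xh//|/(_ i)]; rewrite eqxx.
Qed.

Lemma potential_cyclically_monotone (R : realType) (T1 T2 : Type)
    (c : T1 -> T2 -> R) (A : set (T1 * T2)) (b : T1 -> R) :
  (forall z z', A z -> A z' -> b z.1 + c z'.1 z'.2 <= b z'.1 + c z.1 z'.2) ->
  cyclically_monotone c A.
Proof.
move=> bP k s _ As; rewrite -(lerD2l (\sum_(i < k) b (s i).1)).
(* The two cyclic shifts line up the terms so that [bP] applies to [s i] and [s (ordS i)]. *)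
rewrite [X in _ + X <= _](reindex_inj (@ordS_inj k)).
rewrite [X in _ <= X + _](reindex_inj (@ordS_inj k)) -!big_split/=.
by apply: ler_sum => i _; exact: bP.
Qed.

Lemma solves_MK_cyclically_monotone d1 d2 (T1 : measurableType d1)
    (T2 : measurableType d2) (R : realType) (n : nat) (n_gt0 : (0 < n)%N)
    (X : 'I_n -> T1) (Y : 'I_n -> T2) (c : T1 -> T2 -> R) :
  (forall x : T1, measurable [set x]) -> (forall y : T2, measurable [set y]) ->
  measurable_fun setT (fun z : T1 * T2 => c z.1 z.2) ->
  solves_MK (empirical R n_gt0 X) (empirical R n_gt0 Y) c
    (empirical R n_gt0 (fun i => (X i, Y i))) <->
  cyclically_monotone c (range (fun i => (X i, Y i))).
Proof.
move=> m1 m2 mc; split => [opt|/cyclically_monotone_potential[a aP]].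
  by apply: cyclically_monotone_reindex => s s_inj; exact: solves_MK_reindex opt.
(* Applied in both directions, these inequalities make the potentials agree at repeated points, so
   they descend to functions [g] of [Y i] and [f] of [X i]. *)
have aY i j : Y i = Y j -> a i <= a j.
  by move=> Yij; have := aP i j; rewrite Yij lerD2r.
have aX i j : X i = X j -> a i + c (X i) (Y i) <= a j + c (X j) (Y j).
  by move=> Xij; rewrite -Xij aP.
have [i j Yij|g gY] := @factor_through _ _ R Y (fun i => - a i).
  by congr (- _); apply/eqP; rewrite eq_le !aY.
have [i j Xij|f fX] := @factor_through _ _ R X (fun i => a i + c (X i) (Y i)).
  by apply/eqP; rewrite eq_le !aX.
apply: (@solves_MK_potential _ _ _ _ _ m1 m2 _ _ _ _ _ mc f g) => [i j|i].
  by rewrite fX gY lerBlDl.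
by rewrite fX gY addrC addKr.
Qed.

(** * The positive orthant, the logarithmic cost and homogeneous utilities *)

Section Orthant.
Context (R : realType) (m : nat).
Implicit Types x y : posvec R m.

Lemma measurable_pos_coord (j : 'I_m) : measurable_fun setT (@pos_coord R m j).
Proof.
move=> _ Y mY; rewrite setTI; apply: sub_sigma_algebra => /=.
rewrite -bigcup_seq/=; exists j => /=; first by rewrite mem_index_enum.
by exists Y => //; rewrite setTI.
Qed.

Lemma measurable_posvec_set1 x : measurable [set x].
Proof.
rewrite (_ : [set x] = \bigcap_(j in [set: 'I_m])
    (@pos_coord R m j @^-1` [set pos_coord j x])).
  apply: fin_bigcap_measurable => // j _.
  by rewrite -[X in measurable X]setTI; exact: measurable_pos_coord.
apply/seteqP; split => [_ ->//|y yx]; apply/val_inj/rowP => j.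
exact: (yx j I).
Qed.

Lemma measurable_dotv :
  measurable_fun setT (fun z : posvec R m * posvec R m => dotv z.1 z.2).
Proof.
apply: measurable_sum => j; apply: measurable_funM.
  exact: (measurableT_comp (measurable_pos_coord j) measurable_fst).
exact: (measurableT_comp (measurable_pos_coord j) measurable_snd).
Qed.

Lemma measurable_log_cost :
  measurable_fun setT (fun z : posvec R m * posvec R m => log_cost z.1 z.2).
Proof.
by apply: measurableT_comp; [exact: measurable_ln|exact: measurable_dotv].
Qed.

Lemma dotv_gt0 x y : (0 < m)%N -> 0 < dotv x y.
Proof.
move=> m_gt0; have xy_gt0 j : 0 < vec x 0 j * vec y 0 j.
  rewrite mulr_gt0//; first exact: (forallP (vec_gt0 x)).
  exact: (forallP (vec_gt0 y)).
rewrite /dotv (bigD1 (Ordinal m_gt0))//= ltr_pwDl// sumr_ge0// => j _.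
exact: ltW.
Qed.

Lemma dotv_scalev t x y : dotv (scalev t x) y = t%:num * dotv x y.
Proof. by rewrite /dotv mulr_sumr; apply: eq_bigr => j _; rewrite mxE mulrA. Qed.

Lemma utility_of_potential n (X P : 'I_n -> posvec R m) (a : 'I_n -> R) :
  (0 < m)%N -> (0 < n)%N ->
  (forall i j, a i + log_cost (X i) (P i) <= a j + log_cost (X i) (P j)) ->
  exists u, utility_for (range (fun i => (X i, P i))) u /\
    positive_homogeneous u.
Proof.
move=> m_gt0 n_gt0 aP.
pose F Y i := expR (a i) * dotv Y (P i).
have F_gt0 Y i : 0 < F Y i by rewrite mulr_gt0 ?expR_gt0 ?dotv_gt0.
(* Exponentiating the potential inequality: at [X i] the minimum over indices is attained at [i]. *)
have FX i j : F (X i) i <= F (X i) j.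
  have := aP i j; rewrite -[in X in X -> _]ler_expR !expRD !lnK//;
    exact: dotv_gt0.
pose k Y := [arg min_(i < Ordinal n_gt0) F Y i]%O.
have kP Y i : F Y (k Y) <= F Y i by rewrite /k; case: arg_minP => // j _; apply.
exists (fun Y => F Y (k Y)); split => [_ [i _ <-] Y YX /=|].
  rewrite (le_lt_trans (kP Y i))// (lt_le_trans _ (FX i _))//.
  by rewrite ltr_pM2l ?expR_gt0.
split => // t Y.
have Ft i : F (scalev t Y) i = t%:num * F Y i.
  by rewrite /F dotv_scalev mulrCA.
(* The minimizers for [Y] and for its multiple may differ, so each is tested against the other. *)
apply: le_anti; apply/andP; split; first by rewrite -Ft kP.
by rewrite [leRHS]Ft ler_pM2l// kP.
Qed.

(** Otherwise, scaling [z.1] by [u z'.1 / u z.1] gives a bundle strictly cheaper than [z'.1] at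
    prices [z'.2] but of the same utility, a contradiction. *)
Lemma utility_ratio (A : set (posvec R m * posvec R m)) u z z' :
  (0 < m)%N -> utility_for A u -> positive_homogeneous u -> A z -> A z' ->
  u z.1 * dotv z'.1 z'.2 <= u z'.1 * dotv z.1 z'.2.
Proof.
move=> m_gt0 uA [u_gt0 u_hom] Az Az'; rewrite leNgt; apply/negP => lt_uz.
have t_gt0 : 0 < u z'.1 / u z.1 by rewrite divr_gt0.
have := uA _ Az' (scalev (PosNum t_gt0) z.1).
rewrite dotv_scalev u_hom/= divfK ?gt_eqF// ltxx => /(_ _)/notF; apply.
by rewrite mulrAC ltr_pdivrMr// [ltRHS]mulrC.
Qed.

End Orthant.

Theorem theorem2p10 (R : realType) (m n : nat) (m_gt0 : (0 < m)%N)
    (n_gt0 : (0 < n)%N) (X P : 'I_n -> posvec R m) :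
  let XP : 'I_n -> posvec R m * posvec R m := fun i => (X i, P i) in
  let mu : probability (posvec R m) R := empirical R n_gt0 X in
  let nu : probability (posvec R m) R := empirical R n_gt0 P in
  let pi : probability (posvec R m * posvec R m)%type R :=
    empirical R n_gt0 XP in
  (solves_MK mu nu (@log_cost R m) pi <->
     cyclically_monotone (@log_cost R m) (range XP)) /\
  (cyclically_monotone (@log_cost R m) (range XP) <->
     exists u : posvec R m -> R,
       utility_for (range XP) u /\ positive_homogeneous u).
Proof.
move=> XP mu nu pi; split.
  apply: solves_MK_cyclically_monotone; last exact: measurable_log_cost.
  - exact: measurable_posvec_set1.
  - exact: measurable_posvec_set1.
split => [/cyclically_monotone_potential[a aP]|[u [uXP u_hom]]].
  exact: utility_of_potential aP.
(* With [ln (u x)] as potential, the required inequality is the logarithm of [utility_ratio]. *)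
apply: (@potential_cyclically_monotone _ _ _ _ _ (fun x => ln (u x))).
move=> z z' zXP z'XP /=.
have u_gt0 := u_hom.1.
rewrite /log_cost -!lnM ?posrE ?dotv_gt0// ler_ln ?posrE ?mulr_gt0 ?dotv_gt0//.
exact: utility_ratio uXP u_hom zXP z'XP.
Qed.
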